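(* Let $A$ be a torsion-free abelian group of rank $1$. Then $A$ is weakly uniserial (as a $\mathbb{Z}$-module) if and only if ${\rm type}(A)=[(\alpha_{p})]$ for a height sequence $(\alpha_p)$ such that $\alpha_{p}=0$ for all but finitely many primes $p$ and there is at most one prime $p$ with $\alpha_{p}=\infty$.
   Context: A module $M$ is called weakly uniserial if for any two submodules $N$ and $K$ of $M$ there exists an injective module homomorphism $N\to K$ or an injective module homomorphism $K\to N$. The rank of a torsion-free abelian group $A$ is $\dim_{\mathbb{Q}}(A\otimes_{\mathbb{Z}}\mathbb{Q})$. A height sequence $(\alpha_p)$ is a sequence indexed by the prime numbers $p$ with each $\alpha_p$ a non-negative integer or $\infty$. For a torsion-free abelian group $A$, $a\in A$ and a prime $p$, the $p$-height $h_p(a)$ of $a$ in $A$ is the non-negative integer $n$ with $a\in p^nA\setminus p^{n+1}A$, and $\infty$ if no such $n$ exists; the height sequence of $a$ in $A$ is $h_A(a)=(h_p(a))_p$. Two height sequences $(\alpha_p)$ and $(\beta_p)$ are equivalent if $\alpha_p=\beta_p$ for all but finitely many $p$, and $\alpha_p=\beta_p$ whenever $\alpha_p=\infty$ or $\beta_p=\infty$. This is an equivalence relation, and $[\alpha]$ denotes the class of $\alpha$. For $a\in A$, ${\rm type}_A(a)=[h_A(a)]$. In a torsion-free abelian group of rank $1$ all nonzero elements have the same type, and this common value is denoted ${\rm type}(A)$. *)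

(* Defs.v *)
From HB Require Import structures.
From mathcomp Require Import all_boot all_order all_algebra.
From mathcomp Require Import boolp classical_sets functions cardinality.

Set Implicit Arguments.
Unset Strict Implicit.
Unset Printing Implicit Defensive.

Import GRing.Theory.

Local Open Scope classical_set_scope.
Local Open Scope ring_scope.

(* The submodules of M are the subtypes N : subLmodType P of M, for P any
   predicate on M. Boolean predicates are no restriction: in the classical
   setting of boolp they are all the subsets of M. *)
Definition weakly_uniserial (R : pzRingType) (M : lmodType R) : Prop :=
  forall (P Q : pred M) (N : subLmodType P) (K : subLmodType Q),
    (exists f : {linear N -> K}, injective f) \/
    (exists f : {linear K -> N}, injective f).

Definition torsion_free (A : zmodType) : Prop :=
  forall (a : A) (n : nat), a *+ n = 0 -> n = 0%N \/ a = 0.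

Definition biadditive (A B W : zmodType) (f : A -> B -> W) : Prop :=
  (forall a a' b, f (a + a') b = f a b + f a' b) /\
  (forall a b b', f a (b + b') = f a b + f a b').

(* (T, t) is a tensor product of A and B over the integers. *)
Definition is_tensor_product (A B T : zmodType) (t : A -> B -> T) : Prop :=
  biadditive t /\
  forall (W : zmodType) (f : A -> B -> W), biadditive f ->
    exists2 g : {additive T -> W}, (forall a b, g (t a b) = f a b) &
      forall g' : {additive T -> W},
        (forall a b, g' (t a b) = f a b) -> g' =1 g.

(* The tensor product of A with the rationals is a rational vector space
   through its right factor, and n is its dimension. *)
Definition has_rank (A : zmodType) (n : nat) : Prop :=
  exists (V : vectType rat) (t : A -> rat -> V),
    [/\ is_tensor_product t,
        forall (a : A) (q r : rat), t a (q * r) = q *: t a r &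
        \dim {:V} = n].

(* None stands for infinity. *)
Definition height_sequence := {p : nat | prime p} -> option nat.

Definition multiples (A : zmodType) (n : nat) : set A :=
  range (fun b : A => b *+ n).

Arguments multiples : clear implicits.

Definition height (A : zmodType) (p : nat) (a : A) : option nat :=
  xget None [set Some n | n in
    [set n | (multiples A (p ^ n)%N `\` multiples A (p ^ n.+1)%N) a]].

Definition height_seq (A : zmodType) (a : A) : height_sequence :=
  fun p => height (val p) a.

Definition height_equiv (alpha beta : height_sequence) : Prop :=
  finite_set [set p | alpha p <> beta p] /\
  forall p, alpha p = None \/ beta p = None -> alpha p = beta p.

Definition height_class (alpha : height_sequence) : set height_sequence :=
  [set beta | height_equiv alpha beta].

Definition elt_type (A : zmodType) (a : A) : set height_sequence :=
  height_class (height_seq a).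

(* The common type of the nonzero elements of A. The default value set0 is not
   the class of any height sequence. *)
Definition group_type (A : zmodType) : set height_sequence :=
  xget set0 [set tau | forall a : A, a <> 0 -> elt_type a = tau].

(* Main.v *)
(** Fix a nonzero [a] in [A] and let [D] be the set of positive integers
    dividing [a] in [A], so that [A] is the group of the fractions [z a /
    d] with [d] in [D]. The hypothesis on the type says that the heights
    of [a] almost all vanish and that at most one is infinite; then [D] is
    a chain for divisibility up to a constant factor. Hence a nonzero
    subgroup either has bounded denominators, and is isomorphic to a
    subgroup of Z, which embeds in every nonzero group, or contains [k A]
    for some nonzero [k], and multiplication by [k] embeds everything in
    it. Conversely, for a set [pi] of primes compare the subgroups of
    fractions with [pi]- and [pi']-denominators: an embedding sends [a] to
    an element whose numerator is divisible by every [pi]-number in [D],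
    or the same with [pi'], so one of the two sets of numbers is finite.
    Taking for [pi] a single prime of infinite height, or every other
    prime of nonzero height, gives the condition. *)

Require Import Defs.
From HB Require Import structures.
From mathcomp Require Import all_boot all_order all_algebra.
From mathcomp Require Import generic_quotient ring_quotient.
From mathcomp Require Import ring.
From mathcomp Require Import boolp classical_sets functions cardinality.

Set Implicit Arguments.
Unset Strict Implicit.
Unset Printing Implicit Defensive.

Import Order.TTheory GRing.Theory Num.Theory.

Local Open Scope ring_scope.
Local Open Scope quotient_scope.

(** * Integer multiples in torsion-free groups *)

Lemma morph_add_zmod_morphism (U V : zmodType) (f : U -> V) :
  {morph f : x y / x + y} -> zmod_morphism f.
Proof. by move=> fD x y; rewrite -[in RHS](subrK y x) [in RHS]fD addrK. Qed.

Lemma torsion_free_mulrz_eq0 (A : zmodType) (a : A) (z : int) :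
  torsion_free A -> a <> 0 -> a *~ z = 0 -> z = 0.
Proof.
move=> tfA a0; case: z => n; rewrite ?NegzE ?mulrNz => /eqP.
  by move/eqP/tfA => -[->|].
by rewrite oppr_eq0 => /eqP/tfA => -[|].
Qed.

Lemma torsion_free_mulrzI (A : zmodType) (z : int) (a b : A) :
  torsion_free A -> z != 0 -> a *~ z = b *~ z -> a = b.
Proof.
move=> tfA z0 /eqP; rewrite -subr_eq0 -mulrzBl => /eqP abz0.
apply/eqP; rewrite -subr_eq0; apply/eqP; apply: contrapT => ab0.
by move: z0; rewrite (torsion_free_mulrz_eq0 tfA ab0 abz0).
Qed.

(** * Tensoring with the rationals, and rank one *)

Definition eventually0 (A : zmodType) (u : nat -> A) : bool :=
  `[< exists N, forall n, (N <= n)%N -> u n = 0 >].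

Lemma eventually0_zmod_closed (A : zmodType) : zmod_closed (@eventually0 A).
Proof.
split; first by apply/asboolP; exists 0%N.
move=> u v /asboolP[N uN] /asboolP[M vM]; apply/asboolP.
exists (maxn N M) => n; rewrite geq_max => /andP[/uN un /vM vn].
by have -> : (u - v) n = u n - v n by []; rewrite un vn subrr.
Qed.

Lemma fact_mul_rat_int (q : rat) (n : nat) :
  (`|denq q| <= n)%N -> n`!%:R * q \is a Num.int.
Proof.
move=> qn; have d0 : (0 < `|denq q|)%N by rewrite absz_gt0 denq_neq0.
have /dvdnP[k ->] : (`|denq q| %| n`!)%N by apply: dvdn_fact; rewrite d0.
rewrite natrM -mulrA [_ * q]mulrC natr_absz normr_denq -numqE.
by rewrite rpredM ?rpred_nat ?rpred_int.
Qed.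

(* The class of the sequence (n! q) a, whose terms make sense for all large n,
   in A^nat modulo eventually zero sequences: this quotient is divisible enough
   to receive A (x) Q and torsion-free enough to contain A. *)
Lemma tensor_rat_inj (A V : zmodType) (t : A -> rat -> V) (a : A) :
  torsion_free A -> is_tensor_product t -> t a 1 = 0 -> a = 0.
Proof.
move=> tfA [_ tP] ta0.
pose I : zmodClosed (nat -> A) := HB.pack (@eventually0 A)
  (GRing.isZmodClosed.Build _ _ (@eventually0_zmod_closed A)).
pose f (b : A) (q : rat) : Quotient.quot I :=
  \pi_(Quotient.quot I) (fun n => b *~ Num.floor (n`!%:R * q)).
have piP (u v : nat -> A) :
    \pi_(Quotient.quot I) u = \pi_(Quotient.quot I) v <->
    exists N, forall n, (N <= n)%N -> u n = v n.
  have -> : (\pi_(Quotient.quot I) u = \pi_(Quotient.quot I) v) = (u - v \in I).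
    by rewrite Quotient.idealrBE; apply/propext; split=> /eqP.
  split=> [/asboolP[N uv]|[N uv]]; last apply/asboolP.
    by exists N => n /uv; exact: subr0_eq.
  by exists N => n /uv uvn; have : u n - v n = 0 by rewrite uvn subrr.
have fbi : biadditive f.
  split=> [b b' q|b q r]; rewrite /f -raddfD; apply/piP.
    by exists 0%N => n _; rewrite mulrzDl.
  (* From this index on [n! q] and [n! r] are integers, and [Num.floor] is additive on them. *)
  exists (maxn `|denq q| `|denq r|) => n; rewrite geq_max => /andP[qn rn].
  by rewrite mulrDr floorDzr ?fact_mul_rat_int// mulrzDr.
have [g gt _] := tP _ f fbi.
have /esym := gt a 1; rewrite ta0 raddf0 -(raddf0 (\pi_(Quotient.quot I))).
move=> /piP[N /(_ N (leqnn N))]; rewrite mulr1 => aN0.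
apply: contrapT => a0; move: aN0 => /(torsion_free_mulrz_eq0 tfA a0) /eqP.
by rewrite pmulrn intrKfloor eqz_nat eqn0Ngt fact_gt0.
Qed.

Lemma biadditive_mulrzl (A B W : zmodType) (f : A -> B -> W) a b (z : int) :
  biadditive f -> f (a *~ z) b = f a b *~ z.
Proof.
move=> [fD _]; have fB : zmod_morphism (f^~ b).
  by apply: morph_add_zmod_morphism => x y; exact: fD.
pose fb : {additive A -> W} :=
  HB.pack (f^~ b) (GRing.isZmodMorphism.Build _ _ (f^~ b) fB).
exact: (raddfMz fb).
Qed.

(** If [A] were zero, all [t a q] would vanish, so the identity and the zero map of [V] would both
    factor [t] through itself; uniqueness would make [V] zero. *)
Lemma rank1_nontrivial (A : zmodType) : has_rank A 1 -> exists a : A, a <> 0.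
Proof.
move=> [V [t [[tbi tP] _ V1]]]; apply: contrapT => A0.
have t0 a q : t a q = 0.
  have -> : a = a *~ 0.
    by apply: contrapT => a0; apply: A0; exists a; rewrite -(mulr0z a).
  by rewrite biadditive_mulrzl.
have [g _ gU] := tP V t tbi.
have id0 x : x = 0 :> V.
  have /= -> := gU idfun (fun _ _ => erefl) x.
  by have /= <- := gU \0 (fun a b => esym (t0 a b)) x.
suff: \dim {:V} = 0%N by rewrite V1.
by apply/eqP; rewrite dimv_eq0 -vpick0 (id0 (vpick _)).
Qed.

(** On the line [V], [t a 1] and [t b 1] are rational multiples [k] and [l] of one vector. Clearing
    denominators gives multiples of [a] and [b] with the same image, and [tensor_rat_inj] identifies
    them. *)
Lemma rank1_commensurable (A : zmodType) (a b : A) :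
  torsion_free A -> has_rank A 1 -> a <> 0 ->
  exists2 m : int, m != 0 & exists n : int, b *~ m = a *~ n.
Proof.
move=> tfA [V [t [tT tZ V1]]] a0.
have [[tbi _] tI] := (tT, fun c => tensor_rat_inj (a := c) tfA tT).
set v := vpick {:V}.
have vV : (<[v]> = {:V})%VS.
  by apply/eqP; rewrite eqEdim subvf V1 dim_vline lt0b vpick0 -dimv_eq0 V1.
have tv c : exists k : rat, t c 1 = k *: v.
  by apply/vlineP; rewrite vV memvf.
have [[k ak] [l bl]] := (tv a, tv b).
have k0 : k != 0.
  by apply/eqP => k0; apply: a0; apply: tI; rewrite ak k0 scale0r.
exists (numq k * denq l); first by rewrite mulf_neq0 ?numq_eq0 ?denq_neq0.
exists (numq l * denq k); apply/subr0_eq/tI.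
rewrite -mulrNz tbi.1 !(biadditive_mulrzl _ _ _ tbi); rewrite ak bl.
rewrite -!scaler_int !scalerA -scalerDl.
rewrite mulrNz !intrM !numqE mulNr.
by rewrite [X in X *: _](_ : _ = 0) ?scale0r//; ring.
Qed.

(** * Divisibility and heights *)

Lemma multiples_dvd (A : zmodType) (m n : nat) (a : A) :
  (m %| n)%N -> multiples A n a -> multiples A m a.
Proof.
by move=> /dvdnP[k ->] [b _ <-]; exists (b *+ k) => //; rewrite -mulrnA.
Qed.

Lemma multiplesMz (A : zmodType) (n : nat) (a : A) (z : int) :
  multiples A n a -> multiples A n (a *~ z).
Proof. by move=> [b _ <-]; exists (b *~ z) => //; rewrite !pmulrn mulrzAC. Qed.

(** If [z a = n b] and [u n + v z = 1], then [a = n (u a + v b)]. *)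
Lemma multiplesMz_coprime (A : zmodType) (n : nat) (a : A) (z : int) :
  coprime n `|z| -> multiples A n (a *~ z) -> multiples A n a.
Proof.
move=> nz [b _ /= bE].
have /coprimezP[[u v] /= uv] : coprimez n%:Z z by rewrite /coprimez /gcdz/=.
exists (a *~ u + b *~ v) => //.
rewrite /= pmulrn mulrzDl [b *~ v *~ _]mulrzAC -(pmulrn b) bE -!mulrzA.
by rewrite -mulrzDr [z * v]mulrC uv.
Qed.

(** When no height exists, induction from [p ^ 0 = 1] shows that all powers of [p] divide [a], so
    the default [None] does stand for infinity. *)
Lemma multiples_height (A : zmodType) (p m : nat) (a : A) :
  multiples A (p ^ m)%N a <->
  if height p a is Some n then (m <= n)%N else True.
Proof.
rewrite /height; case: xgetP => [x -> [n [na nNa] <-]|noh].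
  split=> [ma|mn]; last by apply: multiples_dvd na; exact: dvdn_exp2l.
  rewrite leqNgt; apply/negP => nm; apply: nNa; apply: multiples_dvd ma.
  exact: dvdn_exp2l.
split=> // _; elim: m => [|m ma]; first by exists a.
by apply: contrapT => mNa; apply: (noh (Some m)); exists m.
Qed.

Lemma eq_height (A : zmodType) (p : nat) (a b : A) :
  (forall n, multiples A (p ^ n)%N a <-> multiples A (p ^ n)%N b) ->
  height p a = height p b.
Proof.
by move=> ab; rewrite /height; congr xget; congr (image _ _);
  apply/seteqP; split=> n; rewrite /= /setD /= !ab.
Qed.

(** * Equivalence of height sequences and the type of the group *)

Lemma height_equiv_sym (alpha beta : height_sequence) :
  height_equiv alpha beta -> height_equiv beta alpha.
Proof.
move=> [fin inf]; split; last by move=> p /or_comm/inf.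
by apply: sub_finite_set fin => p /= ba; apply: nesym.
Qed.

Lemma height_equiv_trans (alpha beta gamma : height_sequence) :
  height_equiv alpha beta -> height_equiv beta gamma ->
  height_equiv alpha gamma.
Proof.
move=> [fin1 inf1] [fin2 inf2]; split.
  apply: sub_finite_set (_ : finite_set
    ([set p | alpha p <> beta p] `|` [set p | beta p <> gamma p])%classic).
    move=> p /= ac; apply: contrapT => /not_orP[/contrapT ab /contrapT bc].
    by apply: ac; rewrite ab.
  by rewrite finite_setU.
move=> p [ap|cp].
  have ab := inf1 p (or_introl ap).
  by rewrite ab; apply: inf2; left; rewrite -ab.
have bc := inf2 p (or_intror cp).
by rewrite -bc; apply: inf1; right; rewrite bc.
Qed.

Lemma height_class_eq (alpha beta : height_sequence) :
  height_equiv alpha beta -> height_class alpha = height_class beta.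
Proof.
move=> ab; apply/seteqP; split=> gamma; apply: height_equiv_trans => //.
exact: height_equiv_sym.
Qed.

Lemma finite_prime_le (n : nat) :
  finite_set [set p : {p : nat | prime p} | (val p <= n)%N]%classic.
Proof.
apply: (finite_preimage (f := val) (B := `I_n.+1%classic)) (finite_II _).
by move=> p q _ _; exact: val_inj.
Qed.

(** The [p]-part of [z] is cancelled by torsion-freeness, the cofactor by coprimality with [p]. *)
Lemma multiplesMz_ppart (A : zmodType) (p n : nat) (a : A) (z : int) :
  torsion_free A -> prime p -> z != 0 ->
  multiples A (p ^ (logn p `|z| + n))%N (a *~ z) -> multiples A (p ^ n)%N a.
Proof.
move=> tfA p_pr z0 [b _ /= bE].
have z_gt0 : (0 < `|z|)%N by rewrite absz_gt0.
have [m pm zE] := pfactor_coprime p_pr z_gt0.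
apply: (@multiplesMz_coprime _ _ _ (sgz z * m%:Z)).
  by rewrite abszM absz_sg z0 mul1n coprimeXl.
exists b => //=; apply: (@torsion_free_mulrzI _ (p ^ logn p `|z|)%N%:Z) => //.
  by rewrite eqz_nat expn_eq0 -leqn0 leqNgt prime_gt0.
rewrite -pmulrn -mulrnA -expnD addnC bE -mulrzA -mulrA -PoszM -zE.
by rewrite -intEsg.
Qed.

(** Primes above [|z|] are coprime to [z], so the heights there agree; at any [p] multiplication by
    [z] gains at most the [p]-valuation of [z], so it creates no infinite height. *)
Lemma height_equiv_mulrz (A : zmodType) (a : A) (z : int) :
  torsion_free A -> z != 0 ->
  height_equiv (height_seq a) (height_seq (a *~ z)).
Proof.
move=> tfA z0; split.
  apply: sub_finite_set (finite_prime_le `|z|) => p; apply: contra_notT.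
  rewrite -ltnNge => zp; apply: eq_height => n; split; first exact: multiplesMz.
  apply: multiplesMz_coprime; apply: coprimeXl.
  rewrite prime_coprime ?(valP p)//; apply/negP => /dvdn_leq.
  by rewrite absz_gt0 leqNgt zp z0 => /(_ isT).
move=> p [ainf|azinf]; apply: eq_height => n; split; try exact: multiplesMz.
  by move=> _; apply/multiples_height; rewrite [height _ _]ainf.
move=> _; apply: (multiplesMz_ppart (p := val p) (z := z)); rewrite ?(valP p)//.
by apply/multiples_height; rewrite [height _ _]azinf.
Qed.

(** Nonzero elements have a common nonzero multiple, hence equal types; so the set in [group_type]
    is a singleton and the default is not taken. *)
Lemma group_typeE (A : zmodType) (a : A) :
  torsion_free A -> has_rank A 1 -> a <> 0 ->
  group_type A = height_class (height_seq a).
Proof.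
move=> tfA rkA a0; rewrite /group_type.
suff ab (b : A) : b <> 0 -> elt_type b = elt_type a.
  apply: xget_unique => [b|tau]; first exact: ab.
  by move=> /(_ a a0) <-.
move=> b0; have [m m0 [n bm]] := rank1_commensurable b tfA rkA a0.
have n0 : n != 0.
  apply: contra_neq m0 => n0.
  by apply: (torsion_free_mulrz_eq0 tfA b0); rewrite bm n0.
apply: height_class_eq.
apply: height_equiv_trans (height_equiv_mulrz b tfA m0) _.
by rewrite bm; apply/height_equiv_sym/height_equiv_mulrz.
Qed.

(** * Submodules and their denominators *)

(** Weak uniseriality quantifies over structures on a predicate; this provides one to apply it
    to. *)
Lemma inhabited_subLmodType (R : pzRingType) (M : lmodType R) (P : pred M) :
  submod_closed P -> inhabited (subLmodType P).
Proof.
move=> Pcl.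
pose Q : submodClosed M := HB.pack P (GRing.isSubmodClosed.Build _ _ P Pcl).
pose T := {x : M | x \in Q}.
pose N : subLmodType P := HB.pack T [SubChoice_isSubLmodule of T by <:].
exact: inhabits N.
Qed.

(** Away from the only possible prime [q] of infinite height, every divisor [d] of [a] divides [B];
    so [d] divides [B] times its [q]-part, and two divisors compare as their [q]-valuations do. *)
Lemma divisors_chain (A : zmodType) (a : A) :
  finite_set [set p | height_seq a p <> Some 0%N]%classic ->
  is_subset1 [set p | height_seq a p = None]%classic ->
  exists2 B : nat, (0 < B)%N & forall d e : nat, (0 < d)%N -> (0 < e)%N ->
    multiples A d a -> multiples A e a -> (d %| B * e)%N \/ (e %| B * d)%N.
Proof.
move=> /finite_seqP[s sE] inf1.
(* Primes of infinite height contribute the factor 1, by [odflt 0]. *)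
pose B := (\prod_(p <- s) val p ^ odflt 0 (height_seq a p))%N.
have [q qP] : exists q : {p | prime p},
    forall p, height_seq a p = None -> p = q.
  have [[q qinf]|ninf] := pselect (exists q, height_seq a q = None).
    by exists q => p pinf; exact: inf1.
  (* Without infinite heights any prime serves as [q]. *)
  exists (exist _ 2%N isT) => p pinf; by case: ninf; exists p.
have dB (d : nat) : (0 < d)%N -> multiples A d a ->
    (d %| B * val q ^ logn (val q) d)%N.
  move=> d0 da; apply/(dvdn_partP _ d0) => r rd.
  have r_pr : prime r by move: rd; rewrite mem_primes => /and3P[].
  rewrite p_part; have [->|rq] := eqVneq r (val q); first exact: dvdn_mull.
  apply: dvdn_mulr; pose p : {p | prime p} := exist _ r r_pr.
  have rda : multiples A (r ^ logn r d)%N a.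
    apply: multiples_dvd da; exact: pfactor_dvdnn.
  have : height_seq a p <> None.
    by move=> /qP pq; move/eqP: rq; rewrite -pq.
  move/multiples_height: rda; rewrite /height_seq -[r]/(val p).
  case hp : (height _ _) => [n|//] rn _.
  have ps : p \in s.
    have : [set` s]%classic p; last by [].
    rewrite -sE /= /height_seq hp => -[n0]; move: rn; rewrite n0 leqn0.
    by rewrite -[_ == _]negbK -lt0n logn_gt0 rd.
  rewrite /B (big_rem p ps) /= /height_seq hp; apply: dvdn_mulr.
  exact: dvdn_exp2l.
exists B => [|d e d0 e0 da ea].
  by apply: prodn_gt0 => p; rewrite expn_gt0 prime_gt0 ?(valP p).
have [le|/ltnW le] := leqP (logn (val q) d) (logn (val q) e); [left|right].
  apply: dvdn_trans (dB d d0 da) _; apply: dvdn_mul => //.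
  by rewrite pfactor_dvdn ?(valP q).
apply: dvdn_trans (dB e e0 ea) _; apply: dvdn_mul => //.
by rewrite pfactor_dvdn ?(valP q).
Qed.

(** Divide [m] and [n] by their gcd. The Bezout relation says that [b = z a / d] is in lowest terms,
    and later shows that [d] divides [a]. *)
Lemma reduced_fraction (A : zmodType) (a b : A) (m n : int) :
  torsion_free A -> m != 0 -> b *~ m = a *~ n ->
  exists d z u v : int,
    [/\ d != 0, b *~ d = a *~ z & u * d + v * z = 1].
Proof.
move=> tfA m0 bm.
have g0 : gcdz m n != 0 by rewrite gcdz_eq0 negb_and m0.
have /dvdzP[d mE] := dvdz_gcdl m n; have /dvdzP[z nE] := dvdz_gcdr m n.
have [u [v uv]] := Bezoutz m n.
exists d, z, u, v; split.
- by apply: contra_neq m0 => d0; rewrite mE d0 mul0r.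
- by apply: (torsion_free_mulrzI tfA g0); rewrite -!mulrzA -mE -nE.
- by apply: (mulIf g0); rewrite mul1r mulrDl -!mulrA -mE -nE.
Qed.

(** The image of [K] contains a nonzero [c a]. If it misses some [c B y0], with [y0 = z0 a / d0] in
    lowest terms, then [B d0] is a common denominator for [K]: an [x] with denominator [d] not
    dividing [B d0] would have [d0] dividing [B d], which would put [c B y0] in the image. *)
Lemma subgroup_dichotomy (A K : zmodType) (i : {additive K -> A}) (a : A)
    (B : nat) (x0 : K) :
  torsion_free A -> (0 < B)%N ->
  (forall d e : nat, (0 < d)%N -> (0 < e)%N ->
    multiples A d a -> multiples A e a -> (d %| B * e)%N \/ (e %| B * d)%N) ->
  (forall b : A, exists2 m : int, m != 0 & exists n : int, b *~ m = a *~ n) ->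
  injective i -> x0 <> 0 ->
  (exists2 m : int, m != 0 &
    forall x : K, exists z : int, i x *~ m = a *~ z) \/
  (exists2 k : int, k != 0 & forall y : A, exists x : K, i x = y *~ k).
Proof.
move=> tfA B0 chain comm i_inj x00.
have [m m0 [c x0m]] := comm (i x0).
have c0 : c != 0.
  apply/eqP => c0; apply: x00; apply: i_inj; rewrite raddf0.
  by apply: (torsion_free_mulrzI tfA m0); rewrite x0m c0 mul0rz.
(* Here [u a + v b] is [a / d]; [sgz d] replaces [d] by its absolute value. *)
have multiples_den (d z u v : int) (b : A) :
    b *~ d = a *~ z -> u * d + v * z = 1 -> multiples A `|d|%N a.
  move=> bd uv; exists ((a *~ u + b *~ v) *~ sgz d) => //=.
  rewrite pmulrn -mulrzA -intEsg mulrzDl [b *~ v *~ _]mulrzAC bd -!mulrzA.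
  by rewrite -mulrzDr [z * v]mulrC uv.
have dvdBP (d e : int) : (`|d| %| B * `|e|)%N -> exists w, B%:Z * e = w * d.
  by move=> de; apply/dvdzP; rewrite dvdzE abszM.
have [all|] := pselect (forall y : A, exists x : K, i x = y *~ (c * B)).
  by right; exists (c * B) => //; rewrite mulf_neq0// eqz_nat -lt0n.
move=> /existsNP[y0 y0K]; left.
have [n n0 [n' y0n]] := comm y0.
have [d0 [z0 [u0 [v0 [d00 y0d uv0]]]]] := reduced_fraction tfA n0 y0n.
exists (B%:Z * d0); first by rewrite mulf_neq0// eqz_nat -lt0n.
move=> x; have [l l0 [l' xl]] := comm (i x).
have [d [z [u [v [dn0 xd uv]]]]] := reduced_fraction tfA l0 xl.
have [] := chain `|d|%N `|d0|%N _ _ (multiples_den _ _ _ _ _ xd uv)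
  (multiples_den _ _ _ _ _ y0d uv0); rewrite ?absz_gt0//.
  move=> /dvdBP[w ->]; exists (z * w).
  by rewrite [w * d]mulrC !mulrzA xd.
move=> /dvdBP[w wE].
(* With [i x = z a / d] in lowest terms, the image of [K] contains [c a / d]
   by Bezout, and [c B y0] is the multiple [z0 w] of it. *)
case: y0K; exists ((x0 *~ (m * u) + x *~ (c * v)) *~ (z0 * w)).
apply: (torsion_free_mulrzI tfA dn0).
rewrite raddfMz raddfD !raddfMz.
have -> : i x0 *~ (m * u) = a *~ (c * u) by rewrite !mulrzA x0m.
have -> : (a *~ (c * u) + i x *~ (c * v)) *~ (z0 * w) *~ d = a *~ (c * z0 * w).
  rewrite mulrzAC mulrzDl [i x *~ _ *~ _]mulrzAC xd -!mulrzA -mulrzDr -mulrzA.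
  by congr (_ *~ _); rewrite -[RHS]mulr1 -uv; ring.
have -> : y0 *~ (c * B) *~ d = y0 *~ (d0 * (c * w)).
  by rewrite -mulrzA -(mulrA c _ d) wE; congr (_ *~ _); ring.
by rewrite (mulrzA y0) y0d -mulrzA; congr (_ *~ _); ring.
Qed.

(** * Embeddings between subgroups *)

Lemma scale_intE (V : lmodType int) (x : V) (z : int) : z *: x = x *~ z.
Proof. by rewrite -[z in LHS]intz scaler_int. Qed.

Lemma additive_injection (U V : lmodType int) (f : U -> V) :
  {morph f : x y / x + y} -> injective f ->
  exists g : {linear U -> V}, injective g.
Proof.
move=> fD finj; have fB := morph_add_zmod_morphism fD.
pose fa : {additive U -> V} := HB.pack f (GRing.isZmodMorphism.Build _ _ f fB).
have flin : linear f by move=> z x y; rewrite fD !scale_intE [f _](raddfMz fa).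
pose g : {linear U -> V} := HB.pack f (GRing.isLinear.Build _ _ _ _ f flin).
by exists g.
Qed.

(** The numerator [z x] of [i x] over the denominator [m] is unique, hence additive and injective in
    [x]; the embedding is [x] to [z x] times [n0]. *)
Lemma injection_of_bounded (A : zmodType) (N K : lmodType int)
    (i : {additive K -> A}) (iN : {additive N -> A}) (a : A) (n0 : N)
    (m : int) :
  torsion_free A -> a <> 0 -> injective i -> injective iN -> n0 <> 0 ->
  m != 0 ->
  (forall x, exists z : int, i x *~ m = a *~ z) ->
  exists g : {linear K -> N}, injective g.
Proof.
move=> tfA a0 i_inj iN_inj n00 m0 /choice[z zE].
have az0 (b : A) (k l : int) : b <> 0 -> b *~ k = b *~ l -> k = l.
  move=> b0 /eqP; rewrite -subr_eq0 -mulrzBr => /eqP.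
  by move=> /(torsion_free_mulrz_eq0 tfA b0)/subr0_eq.
apply: (@additive_injection _ _ (fun x => n0 *~ z x)) => [x y|x y /(congr1 iN)].
  rewrite -mulrzDr; congr (_ *~ _); apply: (az0 a) => //.
  by rewrite mulrzDr -!zE raddfD mulrzDl.
rewrite !raddfMz => /az0 zxy; apply: i_inj; apply: (torsion_free_mulrzI tfA m0).
by rewrite !zE zxy// => iN0; apply: n00; apply: iN_inj; rewrite raddf0.
Qed.

(** Multiplication by [k] on [A] lifts through [iK]; injectivity of [iK] makes the chosen lift
    additive. *)
Lemma injection_of_multiple (A : zmodType) (N K : lmodType int)
    (iN : {additive N -> A}) (iK : {additive K -> A}) (k : int) :
  torsion_free A -> injective iN -> injective iK -> k != 0 ->
  (forall y : A, exists x : K, iK x = y *~ k) ->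
  exists g : {linear N -> K}, injective g.
Proof.
move=> tfA iN_inj iK_inj k0 /choice[f fE].
apply: (@additive_injection _ _ (f \o iN)) => [x y|x y /= /(congr1 iK)].
  by apply: iK_inj; rewrite /= (raddfD iK) !fE raddfD mulrzDl.
by rewrite !fE => /(torsion_free_mulrzI tfA k0)/iN_inj.
Qed.

Lemma zero_injection (U V : lmodType int) :
  (forall x : U, x = 0) -> exists g : {linear U -> V}, injective g.
Proof.
move=> U0; apply: (@additive_injection _ _ (fun=> 0)) => [x y|x y _].
  by rewrite addr0.
by rewrite (U0 x) (U0 y).
Qed.

Lemma weakly_uniserial_of_chain (A : zmodType) (a : A) (B : nat) :
  torsion_free A -> a <> 0 -> (0 < B)%N ->
  (forall d e : nat, (0 < d)%N -> (0 < e)%N ->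
    multiples A d a -> multiples A e a -> (d %| B * e)%N \/ (e %| B * d)%N) ->
  (forall b : A, exists2 m : int, m != 0 & exists n : int, b *~ m = a *~ n) ->
  weakly_uniserial (zmodule A).
Proof.
move=> tfA a0 B0 chain comm P Q N K.
pose iN : {additive N -> A} := \val; pose iK : {additive K -> A} := \val.
have [iN_inj iK_inj] : injective iN /\ injective iK by split; exact: val_inj.
have [N0|/existsNP[n0 n00]] := pselect (forall x : N, x = 0).
  by left; exact: zero_injection.
have [K0|/existsNP[k0 k00]] := pselect (forall x : K, x = 0).
  by right; exact: zero_injection.
(* The dichotomy for [K] alone decides the direction of the embedding. *)
have [[m m0 mK]|[k kn0 kK]] := subgroup_dichotomy tfA B0 chain comm iK_inj k00.
  by right; exact: (injection_of_bounded tfA a0 iK_inj iN_inj n00 m0 mK).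
by left; exact: (injection_of_multiple tfA iN_inj iK_inj kn0 kK).
Qed.

(** * Necessity: fractions with restricted denominators *)

Definition fractions (A : zmodType) (pi : nat_pred) (a : A) : pred A :=
  fun x => `[< exists2 d : nat, pi.-nat d & exists z : int, x *+ d = a *~ z >].

Lemma fractions_submod_closed (A : zmodType) (pi : nat_pred) (a : A) :
  @submod_closed int (zmodule A) (fractions pi a).
Proof.
split; first by apply/asboolP; exists 1%N => //; exists 0; rewrite mul0rn.
move=> k x y /asboolP[d pid [u xd]] /asboolP[e pie [v ye]]; apply/asboolP.
exists (d * e)%N; first by rewrite pnatM pid pie.
exists (u * k * e%:Z + v * d%:Z).
(* Stated in [A] with [*~], to which the scaling of [zmodule A] is convertible. *)
have linear_comb (x' y' : A) : x' *+ d = a *~ u -> y' *+ e = a *~ v ->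
    (x' *~ k + y') *+ (d * e) = a *~ (u * k * e%:Z + v * d%:Z).
  move=> xd' ye'; rewrite mulrnDl [in RHS]mulrzDr; congr (_ + _).
    by rewrite mulrnA !mulrzA -xd' !pmulrn [_ *~ k *~ _]mulrzAC.
  by rewrite mulrzA -ye' mulnC mulrnA -pmulrn.
exact: linear_comb.
Qed.

(** Let [a] be sent to [z a / e]; then [|z|] is the bound. If [a = d b] with [d] a [pi]-number, then
    [b] lies in [N] and is sent to some [z' a / e'], whence [z e' = z' d e]. As [d] is coprime to
    [e'], it divides [z]. *)
Lemma fractions_injection (A : zmodType) (pi rho : nat_pred) (a : A)
    (N : @subLmodType int (zmodule A) (fractions pi a))
    (K : @subLmodType int (zmodule A) (fractions rho a)) (f : {linear N -> K}) :
  torsion_free A -> a <> 0 -> injective f ->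
  (forall d e, pi.-nat d -> rho.-nat e -> coprime d e) ->
  exists2 B : nat, (0 < B)%N &
    forall d, pi.-nat d -> multiples A d a -> (d %| B)%N.
Proof.
move=> tfA a0 f_inj cop.
pose i : {additive N -> A} := \val; pose g : {additive N -> A} := \val \o f.
have gP x : exists2 e : nat, rho.-nat e & exists z : int, g x *+ e = a *~ z.
  by apply/asboolP; exact: (valP (f x)).
have iP b d (z : int) : pi.-nat d -> b *+ d = a *~ z -> exists x : N, i x = b.
  move=> pid bd; have Pb : fractions pi a b.
    by apply/asboolP; exists d => //; exists z.
  by exists (@Sub _ _ N b Pb); rewrite /i /= SubK.
have g_inj : injective g by move=> x y /val_inj /f_inj.
have [x xa] : exists x : N, i x = a by apply: (iP a 1%N 1).
have [e rhoe [z gxe]] := gP x.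
have e0 : (0 < e)%N by case/andP: rhoe.
have z0 : z != 0.
  apply/eqP => z0; move: gxe; rewrite z0 mulr0z => /tfA[e00|gx0].
    by rewrite e00 in e0.
  by apply: a0; rewrite -xa (_ : x = 0) ?raddf0//; apply: g_inj; rewrite raddf0.
exists `|z|%N; first by rewrite absz_gt0.
move=> d pid [b _ /= bd].
have [y yb] := iP b d 1 pid bd.
have xE : x = y *+ d.
  by apply: (val_inj : injective i); rewrite raddfMn yb bd.
have [e' rhoe' [z' gye']] := gP y.
rewrite -(Gauss_dvdl _ (cop _ _ pid rhoe')).
have : z * e'%:Z = z' * (d * e)%N%:Z.
  apply: subr0_eq; apply: (torsion_free_mulrz_eq0 tfA a0); apply/eqP.
  rewrite mulrzBr subr_eq0 !mulrzA -gxe -gye' xE raddfMn -!pmulrn.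
  by rewrite -!mulrnA; apply/eqP; congr (_ *+ _); ring.
move=> /(congr1 absz); rewrite !abszM /= => ->.
by rewrite mulnCA dvdn_mulr.
Qed.

Lemma weakly_uniserial_bounded (A : zmodType) (a : A) (pi : nat_pred) :
  torsion_free A -> a <> 0 -> weakly_uniserial (zmodule A) ->
  exists2 B : nat, (0 < B)%N &
    (forall d, pi.-nat d -> multiples A d a -> (d %| B)%N) \/
    (forall d, pi^'.-nat d -> multiples A d a -> (d %| B)%N).
Proof.
move=> tfA a0 wu.
have [N] := inhabited_subLmodType (fractions_submod_closed pi a).
have [K] := inhabited_subLmodType (fractions_submod_closed pi^' a).
have [[f f_inj]|[f f_inj]] := wu _ _ N K.
  have [B B0 dB] := fractions_injection tfA a0 f_inj (@pnat_coprime pi).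
  by exists B => //; left.
have cop d e : pi^'.-nat d -> pi.-nat e -> coprime d e.
  by move=> pid pie; rewrite coprime_sym; exact: pnat_coprime pie pid.
have [B B0 dB] := fractions_injection tfA a0 f_inj cop.
by exists B => //; right.
Qed.

(** Take for [pi] the prime [p] alone. For every [B], both [p ^ B] and [q ^ B] divide [a], yet they
    exceed [B] and cannot divide it. *)
Lemma weakly_uniserial_one_infinite (A : zmodType) (a : A) :
  torsion_free A -> a <> 0 -> weakly_uniserial (zmodule A) ->
  is_subset1 [set p | height_seq a p = None]%classic.
Proof.
move=> tfA a0 wu p q /= pinf qinf; apply: contrapT => pq.
have divides (r : {p | prime p}) n :
    height_seq a r = None -> multiples A (val r ^ n)%N a.
  by move=> rinf; apply/multiples_height; rewrite [height _ _]rinf.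
have not_bounded (r : {p | prime p}) B :
    (0 < B)%N -> (val r ^ B %| B)%N -> False.
  move=> B0 /(dvdn_leq B0); rewrite leqNgt ltn_expl//.
  by rewrite prime_gt1 ?(valP r).
have [B B0 [bnd|bnd]] := weakly_uniserial_bounded (val p) tfA a0 wu.
  apply: (not_bounded p B B0); apply: bnd; last exact: divides.
  by rewrite pnatX pnat_id ?(valP p).
apply: (not_bounded q B B0); apply: bnd; last exact: divides.
rewrite pnatX pnatE ?(valP q)// !inE /=.
by rewrite eq_sym; apply/orP; left; apply/eqP => qp; apply: pq; apply: val_inj.
Qed.

(** An infinite support contains a sequence [h] of distinct primes, all dividing [a]. With the
    even-indexed ones in [pi] and the odd-indexed ones outside, either bound [B] would have
    infinitely many divisors. *)
Lemma weakly_uniserial_finite_support (A : zmodType) (a : A) :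
  torsion_free A -> a <> 0 -> weakly_uniserial (zmodule A) ->
  finite_set [set p | height_seq a p <> Some 0%N]%classic.
Proof.
move=> tfA a0 wu; apply: contrapT => /infiniteP/card_leP[f].
pose h n := val (f (to_setT n)).
have divides n : multiples A (val (h n)) a.
  have /= := set_mem (valP (f (to_setT n))); rewrite -/(h n) /height_seq => hn0.
  rewrite -[X in multiples _ X _]expn1.
  apply/multiples_height; case: (height _ _) hn0 => [[|]|]//.
have h_inj' m n : val (h m) = val (h n) -> m = n.
  move=> /val_inj/val_inj/(@inj _ _ _ f).
  by rewrite !inE => /(_ I I)/(congr1 val).
have not_bounded (g : nat -> nat) B : injective g -> (0 < B)%N ->
    (forall n, val (h (g n)) %| B)%N -> False.
  move=> g_inj B0 gB; apply: infinite_nat.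
  apply: sub_finite_set
    (_ : finite_set ((fun n => val (h (g n))) @^-1` `I_B.+1)).
    by move=> n _; exact: dvdn_leq B0 (gB n).
  by apply: finite_preimage (finite_II _) => m n _ _ /h_inj'/g_inj.
pose pi : nat_pred := [pred r | `[< exists n, r = val (h n.*2) >]].
have pi_even n : val (h n.*2) \in pi by apply/asboolP; exists n.
have pi_odd n : val (h n.*2.+1) \in pi^'.
  apply/asboolPn => -[m /h_inj'/(congr1 odd)].
  by rewrite /= !odd_double.
have [B B0 [bnd|bnd]] := weakly_uniserial_bounded pi tfA a0 wu.
  apply: (not_bounded double B double_inj B0) => n.
  by apply: bnd (divides _); rewrite pnatE ?(valP (h _)).
apply: (not_bounded (fun n => n.*2.+1) B _ B0) => [m n [/double_inj//]|n].
by apply: bnd (divides _); rewrite pnatE ?(valP (h _)).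
Qed.

Theorem theorem4p6 (A : zmodType) (A_torsion_free : torsion_free A)
    (A_rank1 : has_rank A 1) :
  weakly_uniserial (zmodule A) <->
  exists alpha : height_sequence,
    [/\ group_type A = height_class alpha,
        finite_set [set p | alpha p <> Some 0%N]%classic &
        is_subset1 [set p | alpha p = None]%classic].
Proof.
have [a a0] := rank1_nontrivial A_rank1.
have typeA := group_typeE A_torsion_free A_rank1 a0.
split=> [wu|[alpha [alphaA alpha_fin alpha_inf]]].
  exists (height_seq a); split=> //.
    exact: weakly_uniserial_finite_support.
  exact: weakly_uniserial_one_infinite.
(* Since [alpha] belongs to its own class, it is equivalent to the heights of [a], and both
   conditions on [alpha] pass to them. *)
have [aa_fin aa_inf] : height_equiv (height_seq a) alpha.
  have : height_class alpha alpha.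
    split=> //; apply: sub_finite_set (finite_set0 _) => p; exact.
  by rewrite -alphaA typeA.
have [] := @divisors_chain A a.
- apply: sub_finite_set (_ : finite_set
    ([set p | height_seq a p <> alpha p] `|`
     [set p | alpha p <> Some 0%N])%classic).
    move=> p /= ap.
    by have [<-|ne] := pselect (height_seq a p = alpha p); [right|left].
  by rewrite finite_setU.
- move=> p q /= pinf qinf; apply: alpha_inf => /=.
    by rewrite -aa_inf//; left.
  by rewrite -aa_inf//; left.
move=> B B0 chain; apply: weakly_uniserial_of_chain chain _ => //.
by move=> b; exact: rank1_commensurable.
Qed.
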